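(* Let $n\ge2$ and $m,p,q,T\ge 1$ be integers, $\sigma>0$, $A^*\in\mathbb{R}_+^{n\times m}$ with every row of $\ell_1$-norm $1$, $B^*\in\mathbb{R}^{q\times p}$, and let $X_1,\dots,X_T\in\mathbb{R}^{m\times q}$ be fixed design matrices with $Y_t=A^*X_tB^*+E_t$ for $t\in\{1,\dots,T\}$, where all entries of all the matrices $E_t\in\mathbb{R}^{n\times p}$ are i.i.d. $\mathcal N(0,\sigma^2)$. Assume that $\mathbb{X}^\top\mathbb{X}=T\cdot I_{mq}$, that $0<[A^*]_{ik}<1$ for all $(i,k)\in[n]\times[m]$, and that $\beta^*>0$, where $\beta^*:=\frac{1}{pq}\sum_{j=1}^p\sum_{l=1}^q[B^*]_{lj}$. Let $\mu_{ik}:=\beta^*(1-[A^*]_{ik})$, $\nu_{ik}:=[A^*]_{ik}\beta^*$, $\mu:=\min_{i,k}\mu_{ik}$, $\nu:=\min_{i,k}\nu_{ik}$ and $\tilde\sigma:=\sigma\sqrt{1+\frac{m}{n-1}}$. Then the estimator $\hat A$ (defined in the context) satisfies, for any $\epsilon>0$, $$\mathbb{P}\left[\|\hat A-A^*\|_+>\frac{2\epsilon}{|\beta^*|}\right]\le \frac{nm\sigma\sqrt2}{\epsilon\sqrt{pqT\pi}}\left[\exp\left(-\frac{Tpq\,\epsilon^2}{2\sigma^2}\right)+\frac{\sqrt m}{\sqrt{n-1}}\exp\left(-\frac{Tpq(n-1)\epsilon^2}{2m\sigma^2}\right)\right]$$ $$\qquad+\frac{nm}{\sqrt{2pqT\p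i}}\left[\frac{\tilde\sigma}{\mu}\exp\left(-\frac{Tpq\,\mu^2}{2\tilde\sigma^2}\right)+\frac{\sigma}{\nu}\exp\left(-\frac{Tpq\,\nu^2}{2\sigma^2}\right)\right].$$
   Context: $[N]=\{1,\dots,N\}$; $\mathrm{vec}(\cdot)$ denotes column-wise vectorization. $\mathbb{Y}:=(\mathrm{vec}(Y_1),\dots,\mathrm{vec}(Y_T))^\top\in\mathbb{R}^{T\times np}$, $\mathbb{X}:=(\mathrm{vec}(X_1),\dots,\mathrm{vec}(X_T))^\top\in\mathbb{R}^{T\times mq}$, and $\widehat{\mathbb C}:=(\mathbb X^\top\mathbb X)^{-1}\mathbb X^\top\mathbb Y\in\mathbb{R}^{mq\times np}$. For a matrix $\mathbb{G}\in\mathbb{R}^{mq\times np}$, $[\mathbb{G}]_{(k,l)}^{(i,j)}$ denotes the entry in row $k+(l-1)m$ and column $i+(j-1)n$, for $k\in[m]$, $l\in[q]$, $i\in[n]$, $j\in[p]$. The estimators are $$[\tilde B]^{(i)}_{lj}:=\frac{1}{n-1}\sum_{r\in[n],\,r\ne i}\ \sum_{s=1}^m[\widehat{\mathbb C}]_{(s,l)}^{(r,j)},\qquad [\tilde A]_{ik}:=\frac{\sum_{j=1}^p\sum_{l=1}^q[\widehat{\mathbb C}]_{(k,l)}^{(i,j)}}{\sum_{j=1}^p\sum_{l=1}^q[\tilde B]_{lj}^{(i)}},\qquad [\hat A]_{ik}:=\max\left(0,\min([\tilde A]_{ik},1)\right)$$ for $(i,k)\in[n]\times[m]$ (the denominator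 is nonzero almost surely). $\|\cdot\|_+$ is the elementwise maximum norm (maximum absolute value of the entries). *)

(* Defs.v *)
From HB Require Import structures.
From mathcomp Require Import all_boot all_order all_algebra.
From mathcomp Require Import all_classical all_reals all_analysis.

Set Implicit Arguments.
Unset Strict Implicit.
Unset Printing Implicit Defensive.

Import Order.TTheory GRing.Theory Num.Theory.
Import numFieldNormedType.Exports.

Local Open Scope classical_set_scope.
Local Open Scope ring_scope.

(* The product rule is required for every subfamily of the finite family X. *)
Definition mutually_independent d (Omega : measurableType d) (R : realType)
    (P : probability Omega R) (I : finType) (X : I -> {RV P >-> R}) : Prop :=
  forall (J : {set I}) (B : I -> set R),
    (forall i, i \in J -> measurable (B i)) ->
    P (\bigcap_(i in [set` J]) (X i @^-1` B i)) =
    (\prod_(i in J) P (X i @^-1` B i))%E.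

Section Estimators.
Variable R : realType.

Definition mean_entry q p (B : 'M[R]_(q, p)) : R :=
  (p%:R * q%:R)^-1 * \sum_(j < p) \sum_(l < q) B l j.

(* This is the minimum of the entries as soon as M has at least one entry, see
   [min_entryP]. *)
Definition min_entry n m (M : 'M[R]_(n, m)) : R :=
  inf [set M ik.1 ik.2 | ik in [set: 'I_n * 'I_m]].

Lemma min_entryP n m (M : 'M[R]_(n, m)) : (0 < n)%N -> (0 < m)%N ->
  (exists i k, min_entry M = M i k) /\ (forall i k, min_entry M <= M i k).
Proof.
move=> n0 m0; pose ik0 := (Ordinal n0, Ordinal m0).
have [[i k] _ /= ikP] :=
  @arg_minP _ _ _ ik0 predT (fun ik : 'I_n * 'I_m => M ik.1 ik.2) isT.
suff -> : min_entry M = M i k.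
  by split; [exists i, k | move=> i' k'; apply: (ikP (i', k'))].
apply/eqP; rewrite eq_le; apply/andP; split.
  apply: ge_inf; last by exists (i, k).
  by exists (M i k) => _ [ik _ <-]; exact: ikP.
apply: lb_le_inf; first by exists (M i k), (i, k).
by move=> _ [ik _ <-]; exact: ikP.
Qed.

(* [mxvec] is row-major, so the column-wise vectorization of an [a x b] matrix
   is the [mxvec] of its transpose; its length is written [b * a]. *)
Definition vec_rows T a b (M : 'I_T -> 'M[R]_(a, b)) : 'M[R]_(T, b * a) :=
  \matrix_(t < T) mxvec (M t)^T.

(* Zero-based counterpart of the index k + (l - 1) m. *)
Lemma val_mxvec_index q m (l : 'I_q) (k : 'I_m) :
  mxvec_index l k = (k + l * m)%N :> nat.
Proof.
have index_pairs (s : seq 'I_q) (t : seq 'I_m) : l \in s -> k \in t ->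
    index (l, k) [seq (x, y) | x <- s, y <- t] = (index k t + index l s * size t)%N.
  move=> ls kt; elim: s ls => [//|x s IH]; rewrite in_cons /=.
  rewrite index_cat /= eq_sym; have [->|xl] := eqVneq l x.
    rewrite mem_map ?kt; last by move=> y z [].
    by rewrite index_map ?mul0n ?addn0// => y z [].
  rewrite /= => /IH IHs; have [/mapP[y _ [lx _]]|_] := boolP (_ \in _).
    by rewrite lx eqxx in xl.
  by rewrite IHs size_map mulSn addnCA.
rewrite /= /enum_rank [enum_rank_in]unlock insubdK; last first.
  by rewrite unfold_in cardE index_mem mem_enum.
rewrite enumT unlock /= /prod_enum index_pairs ?mem_enum//.
by rewrite !index_enum_ord size_enum_ord.
Qed.

Definition ols T m q n p (X : 'I_T -> 'M[R]_(m, q)) (Y : 'I_T -> 'M[R]_(n, p))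
    : 'M[R]_(q * m, p * n) :=
  invmx ((vec_rows X)^T *m vec_rows X) *m (vec_rows X)^T *m vec_rows Y.

Definition block_entry m q n p (G : 'M[R]_(q * m, p * n))
    (k : 'I_m) (l : 'I_q) (i : 'I_n) (j : 'I_p) : R :=
  G (mxvec_index l k) (mxvec_index j i).

Definition B_tilde m q n p (C : 'M[R]_(q * m, p * n)) (i : 'I_n)
    : 'M[R]_(q, p) :=
  \matrix_(l < q, j < p)
    ((n%:R - 1)^-1 *
     \sum_(r < n | r != i) \sum_(s < m) block_entry C s l r j).

(* Division by zero yields 0 here; the denominator vanishes only on a null
   event in the Gaussian model. *)
Definition A_tilde m q n p (C : 'M[R]_(q * m, p * n)) : 'M[R]_(n, m) :=
  \matrix_(i < n, k < m)
    ((\sum_(j < p) \sum_(l < q) block_entry C k l i j) /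
     (\sum_(j < p) \sum_(l < q) B_tilde C i l j)).

Definition A_hat m q n p (C : 'M[R]_(q * m, p * n)) : 'M[R]_(n, m) :=
  \matrix_(i < n, k < m) Num.max 0 (Num.min (A_tilde C i k) 1).

End Estimators.

(* Main.v *)
Require Import Defs.
From HB Require Import structures.
From mathcomp Require Import all_boot all_order all_algebra.
From mathcomp Require Import all_classical all_reals all_analysis.
From mathcomp Require Import measurable_realfun ring lra.

(** The least squares entries are [A i k * B l j] plus a linear form in the noise,
    so averaging over [(l, j)] gives a numerator [beta * A i k + u] and a
    denominator [beta + v], where [u], [v] and [u - v] are centred Gaussian with
    variances [sigma^2 / Tpq] times [1], [m / (n - 1)] and [1 + m / (n - 1)]. As
    soon as [u > - nu] and [u - v < mu], the ratio lies in the open unit interval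
    and truncation is inactive; if moreover [`|u|] and [`|v|] are at most [eps],
    the error is at most [2 * eps / beta]. The bound is the sum over [(i, k)] of
    the six Gaussian tails that control these four events. *)

Set Implicit Arguments.
Unset Strict Implicit.
Unset Printing Implicit Defensive.

Import Order.TTheory GRing.Theory Num.Theory.
Import numFieldNormedType.Exports.

Local Open Scope classical_set_scope.
Local Open Scope ring_scope.

(** * Image measures and affine substitution in Lebesgue integrals *)

(* The library's measure structure on [pushforward] is indexed by a measurability
   proof that unification does not find; [mfun] carries it. *)
Definition image_measure d d' (T : measurableType d) (T' : measurableType d')
    (R : realType) (mu : {measure set T -> \bar R}) (f : {mfun T >-> T'}) :
    set T' -> \bar R :=
  pushforward mu f.

Section image_measure.
Context d d' (T : measurableType d) (T' : measurableType d') (R : realType).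
Variables (mu : {measure set T -> \bar R}) (f : {mfun T >-> T'}).

Let image_measure0 : image_measure mu f set0 = 0%E.
Proof. exact: measure0. Qed.

Let image_measure_ge0 A : (0 <= image_measure mu f A)%E.
Proof. exact: measure_ge0. Qed.

Let image_measure_sigma_additive : semi_sigma_additive (image_measure mu f).
Proof. exact: measure_semi_sigma_additive. Qed.

HB.instance Definition _ := isMeasure.Build _ _ _ (image_measure mu f)
  image_measure0 image_measure_ge0 image_measure_sigma_additive.

End image_measure.

Section affine_map.
Context (R : realType).
Variables c b : R.

Definition affine_map (x : measurableTypeR R) : measurableTypeR R := c * x + b.

Lemma measurable_affine_map : measurable_fun [set: R] affine_map.
Proof. by apply: measurable_funD => //; exact: measurable_funM. Qed.

HB.instance Definition _ :=
  isMeasurableFun.Build _ _ _ _ affine_map measurable_affine_map.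

End affine_map.

(** By uniqueness of Lebesgue measure, half-open intervals suffice. A negative [c] moves the closed
    end to the other side, which leaves the length unchanged. *)
Lemma lebesgue_measure_affine (R : realType) (c b : R) (V : set R) : c != 0 ->
  measurable V ->
  lebesgue_measure V =
  mscale (NngNum (normr_ge0 c)) (image_measure lebesgue_measure (affine_map c b)) V.
Proof.
move=> c0 mV; apply: lebesgue_measure_unique => // X [[u v] _ <-].
rewrite /= /mscale /image_measure /pushforward/=.
have [c_gt0|c_lt0|/eqP] := ltrgt0P c; last by rewrite (negbTE c0).
- have -> : affine_map c b @^-1` `]u, v] = `](u - b) / c, (v - b) / c]%classic.
    apply/seteqP; split => x /=; rewrite /affine_map !in_itv/= ltr_pdivrMr//;
      by rewrite ler_pdivlMr// [x * c]mulrC ltrBlDr lerBrDr.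
  rewrite !lebesgue_measure_itv/= !lte_fin ltr_pM2r ?invr_gt0// ltrD2r.
  case: ifPn => _; last by rewrite mule0.
  by rewrite -EFinM; congr EFin; field.
- have -> : affine_map c b @^-1` `]u, v] = `[(v - b) / c, (u - b) / c[%classic.
    apply/seteqP; split => x /=; rewrite /affine_map !in_itv/= ler_ndivrMr//;
      by rewrite ltr_ndivlMr// [x * c]mulrC ltrBlDr lerBrDr andbC.
  rewrite !lebesgue_measure_itv/= !lte_fin ltr_nM2r ?invr_lt0// ltrD2r.
  case: ifPn => _; last by rewrite mule0.
  by rewrite -EFinM; congr EFin; field.
Qed.

Lemma ge0_integral_affine (R : realType) (c b : R) (f : R -> \bar R) : c != 0 ->
  measurable_fun [set: R] f -> (forall x, 0 <= f x)%E ->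
  (\int[lebesgue_measure]_x f x =
   `|c|%:E * \int[lebesgue_measure]_x f (c * x + b)%R)%E.
Proof.
move=> c0 mf f0.
rewrite (eq_measure_integral
  (mscale (NngNum (normr_ge0 c)) (image_measure lebesgue_measure (affine_map c b)))).
  by rewrite ge0_integral_mscale//= ge0_integral_pushforward.
by move=> A mA _; exact: lebesgue_measure_affine.
Qed.

(** * Gaussian laws: densities, scaling and sums *)

(** Change of variables holds for the abstract Radon-Nikodym derivative, which agrees almost
    everywhere with [normal_pdf] because both have the same integral over every measurable set. *)
Lemma ge0_integral_normal_prob (R : realType) (m s : R) (f : R -> \bar R) :
  measurable_fun [set: R] f -> (forall x, 0 <= f x)%E ->
  (\int[normal_prob m s]_x f x =
   \int[lebesgue_measure]_x (f x * (normal_pdf m s x)%:E))%E.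
Proof.
move=> mf f0; have dom := normal_prob_dominates m s.
rewrite -(Radon_Nikodym_SigmaFinite.change_of_variables dom)//.
apply: ae_eq_integral => //.
- apply: emeasurable_funM => //.
  apply: (measurable_int lebesgue_measure).
  exact: Radon_Nikodym_SigmaFinite.f_integrable.
- apply: emeasurable_funM => //.
  by apply/measurable_EFinP; exact: measurable_normal_pdf.
- suff : ae_eq lebesgue_measure setT
      (Radon_Nikodym_SigmaFinite.f (normal_prob m s) lebesgue_measure)
      (fun x => (normal_pdf m s x)%:E).
    by apply: filterS => x /= + Dx => ->.
  apply: integral_ae_eq => //.
  + exact: Radon_Nikodym_SigmaFinite.f_integrable.
  + by apply/measurable_EFinP; exact: measurable_normal_pdf.
  + by move=> A _ mA; rewrite -Radon_Nikodym_SigmaFinite.f_integral.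
Qed.

Lemma normal_prob_indic (R : realType) (m s : R) (V : set R) : measurable V ->
  normal_prob m s V =
  (\int[lebesgue_measure]_x (normal_pdf m s x * \1_V x)%:E)%E.
Proof.
move=> mV; rewrite /normal_prob integral_mkcond; apply: eq_integral => x _.
by rewrite patchE indicE; case: ifPn => _; rewrite ?mulr1 ?mulr0.
Qed.

Lemma measurable_normal_pdf_indic (R : realType) (m s : R) (V : set R) :
  measurable V ->
  measurable_fun [set: R] (fun x => (normal_pdf m s x * \1_V x)%:E).
Proof.
move=> mV; apply/measurable_EFinP; apply: measurable_funM => //.
exact: measurable_normal_pdf.
Qed.

Lemma normal_pdf_scale (R : realType) (s c x : R) : c != 0 -> s != 0 ->
  `|c| * normal_pdf 0 (`|c| * s) (c * x) = normal_pdf 0 s x.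
Proof.
move=> c0 s0; rewrite !normal_pdfE ?mulf_neq0 ?normr_eq0//.
rewrite mulrA; congr (_ * _).
  rewrite /normal_peak.
  have -> : (`|c| * s) ^+ 2 * pi *+ 2 = c ^+ 2 * (s ^+ 2 * pi *+ 2).
    by rewrite exprMn real_normK ?num_real// -mulrA mulrnAr.
  rewrite sqrtrM ?sqr_ge0// sqrtr_sqr invfM mulrA.
  by rewrite divff ?normr_eq0// mul1r.
rewrite /normal_fun !subr0 !exprMn real_normK ?num_real//.
by congr expR; field; rewrite c0 s0.
Qed.

(** The substitution [c * x] produces the Jacobian [|c|], which [normal_pdf_scale] absorbs into the
    standard deviation. *)
Lemma normal_prob_scale (R : realType) (s c : R) (V : set R) :
  c != 0 -> s != 0 -> measurable V ->
  normal_prob 0 s [set x | V (c * x)] = normal_prob 0 (`|c| * s) V.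
Proof.
move=> c0 s0 mV; have mcV : measurable [set x | V (c * x)].
  rewrite -[X in measurable X]setTI.
  have mc : measurable_fun [set: R] (fun x => c * x) by exact: measurable_funM.
  exact: mc.
rewrite !normal_prob_indic// [RHS](@ge0_integral_affine _ c 0)//.
- rewrite -ge0_integralZl//=.
  + apply: eq_integral => x _; rewrite addr0 -EFinM mulrA normal_pdf_scale//.
  + apply/measurable_EFinP.
    apply: measurable_funM.
      apply: (measurableT_comp (measurable_normal_pdf _ _)).
      exact: measurable_affine_map.
    apply: (measurableT_comp (measurable_indic mV)).
    exact: measurable_affine_map.
  + by move=> x _; rewrite lee_fin mulr_ge0// normal_pdf_ge0.
- exact: measurable_normal_pdf_indic.
- by move=> x; rewrite lee_fin mulr_ge0// normal_pdf_ge0.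
Qed.

(* Completing the square in [y]. *)
Lemma normal_pdf_conv (R : realType) (s t c x y : R) : 0 < s -> 0 < t ->
  let S := Num.sqrt ((c * t) ^+ 2 + s ^+ 2) in
  normal_pdf 0 s (x - c * y) * normal_pdf 0 t y =
  normal_pdf 0 S x * normal_pdf (c * t ^+ 2 * x / S ^+ 2) (s * t / S) y.
Proof.
move=> s0 t0 S.
have D0 : 0 < (c * t) ^+ 2 + s ^+ 2 by rewrite ltr_wpDl ?sqr_ge0// exprn_gt0.
have S0 : 0 < S by rewrite sqrtr_gt0.
have SE : S ^+ 2 = (c * t) ^+ 2 + s ^+ 2 by rewrite sqr_sqrtr// ltW.
clearbody S.
rewrite !normal_pdfE ?gt_eqF// ?divr_gt0 ?mulr_gt0//.
rewrite mulrACA [RHS]mulrACA; congr (_ * _).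
  rewrite /normal_peak -!invfM; congr _^-1.
  have peak2_ge0 (z : R) : 0 <= z ^+ 2 * pi *+ 2.
    by rewrite mulrn_wge0// mulr_ge0 ?sqr_ge0 ?pi_ge0.
  rewrite -(sqrtrM _ (peak2_ge0 s)) -(sqrtrM _ (peak2_ge0 S)).
  by congr Num.sqrt; field; rewrite gt_eqF.
rewrite /normal_fun -!expRD; congr expR.
rewrite !exprMn exprVn SE.
by field; rewrite !gt_eqF// -exprMn.
Qed.

Lemma measurable_linear_set (R : realType) (c : R) (V : set R) : measurable V ->
  measurable [set z : measurableTypeR R * measurableTypeR R | V (c * z.1 + z.2)].
Proof.
move=> mV; rewrite -[X in measurable X]setTI.
have mf : measurable_fun [set: measurableTypeR R * measurableTypeR R]
    (fun z : measurableTypeR R * measurableTypeR R => c * z.1 + z.2).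
  by apply: measurable_funD => //; exact: measurable_funM.
exact: mf.
Qed.

(** After a shift by [c * y] and an exchange of integrals, [normal_pdf_conv] splits the integrand
    into the density of the sum at [x] and a Gaussian density in [y], whose integral is one. *)
Lemma normal_prob_conv (R : realType) (s t c : R) (V : set R) :
  0 < s -> 0 < t -> measurable V ->
  (normal_prob 0 t \x normal_prob 0 s)%E [set z | V (c * z.1 + z.2)] =
  normal_prob 0 (Num.sqrt ((c * t) ^+ 2 + s ^+ 2)) V.
Proof.
move=> s0 t0 mV; set S := Num.sqrt _; rewrite /product_measure1/=.
have mlin := measurable_linear_set c mV.
rewrite ge0_integral_normal_prob//; last first.
  exact: measurable_fun_xsection.
transitivity (\int[lebesgue_measure]_y \int[lebesgue_measure]_x
   (normal_pdf 0 s (x - c * y) * normal_pdf 0 t y * \1_V x)%:E)%E.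
  apply: eq_integral => y _.
  have -> : xsection [set z | V (c * z.1 + z.2)] y = [set x | V (x + c * y)].
    by apply/seteqP; split => x; rewrite /xsection/= inE/= addrC.
  have mW : measurable [set x | V (x + c * y)].
    rewrite -[X in measurable X]setTI.
    have mD : measurable_fun [set: R] (fun x => x + c * y) by exact: measurable_funD.
    exact: mD.
  rewrite normal_prob_indic// (@ge0_integral_affine _ 1 (- (c * y)))//; last 2 first.
  - exact: measurable_normal_pdf_indic.
  - by move=> x; rewrite lee_fin mulr_ge0// normal_pdf_ge0.
  rewrite normr1 mul1e -ge0_integralZr//=.
  - apply: eq_integral => x _; rewrite mul1r -EFinM mulrAC.
    rewrite !indicE; have -> // : (x + - (c * y) \in [set x | V (x + c * y)]) = (x \in V).
    by apply/idP/idP; rewrite !inE/= subrK.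
  - apply: (measurableT_comp (measurable_normal_pdf_indic _ _ mW)).
    exact: measurable_affine_map.
  - by move=> x _; rewrite lee_fin mulr_ge0// normal_pdf_ge0.
  - by rewrite lee_fin normal_pdf_ge0.
rewrite (@fubini_tonelli _ _ _ _ R lebesgue_measure lebesgue_measure
  (fun z => (normal_pdf 0 s (z.2 - c * z.1) * normal_pdf 0 t z.1 * \1_V z.2)%:E))//=.
- rewrite normal_prob_indic//; apply: eq_integral => x _.
  under eq_integral => y _ do rewrite normal_pdf_conv// -/S mulrAC EFinM.
  rewrite ge0_integralZl//=.
  + by rewrite integral_normal_pdf mule1.
  + by apply/measurable_EFinP; exact: measurable_normal_pdf.
  + by move=> y _; rewrite lee_fin normal_pdf_ge0.
  + by rewrite lee_fin mulr_ge0// normal_pdf_ge0.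
- apply/measurable_EFinP; apply: measurable_funM.
    apply: measurable_funM.
      apply: (measurableT_comp (measurable_normal_pdf _ _)).
      by apply: measurable_funB => //; exact: measurable_funM.
    exact: (measurableT_comp (measurable_normal_pdf _ _)).
  exact: (measurableT_comp (measurable_indic mV)).
- by move=> z; rewrite lee_fin !mulr_ge0// normal_pdf_ge0.
Qed.

(** * Upper bound on Gaussian tails *)

(** Transfers the decay of [gauss_fun] at infinity to [normal_fun]. *)
Lemma normal_fun_gauss (R : realType) (s x : R) : 0 < s ->
  normal_fun 0 s x = gauss_fun ((s * Num.sqrt 2)^-1 * x).
Proof.
move=> s0; rewrite /normal_fun /gauss_fun subr0 !(exprMn, exprVn).
rewrite sqr_sqrtr ?ler0n//.
by congr expR; field; rewrite gt_eqF.
Qed.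

Lemma is_derive_normal_fun (R : realType) (s x : R) : 0 < s ->
  is_derive x 1 (normal_fun 0 s) (- (x / s ^+ 2) * normal_fun 0 s x).
Proof.
move=> s0; have sN0 : s != 0 by rewrite gt_eqF.
have -> : normal_fun 0 s = expR \o (fun y => - (2 * s ^+ 2)^-1 * y ^+ 2).
  apply/funext => y; rewrite /normal_fun /= subr0; congr expR.
  by field; rewrite sN0.
have dg : is_derive x 1 (fun y : R => - (2 * s ^+ 2)^-1 * y ^+ 2) (- (x / s ^+ 2)).
  by apply: is_derive_eq; rewrite /GRing.scale/=; field; rewrite sN0.
rewrite [X in is_derive _ _ _ X]mulrC.
exact: is_derive1_comp (is_derive_expR _) dg.
Qed.

(* The tail integral is increased by the factor [y / x >= 1], after which it has
   an explicit primitive. *)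
Lemma normal_prob_tail (R : realType) (s x : R) : 0 < s -> 0 < x ->
  (normal_prob 0 s `[x, +oo[ <=
   (s / (x * Num.sqrt (2 * pi)) * expR (- (x ^+ 2 / (2 * s ^+ 2))))%:E)%E.
Proof.
move=> s0 x0; rewrite /normal_prob.
have sN0 : s != 0 by rewrite gt_eqF.
have xN0 : x != 0 by rewrite gt_eqF.
(* With this [K], [f] is the density times [y / x]. Its primitive [F] vanishes at infinity, so the
   integral of [f] over the tail is [- F x]. *)
pose K := normal_peak s * s ^+ 2 / x.
have K0 : 0 <= K by rewrite !mulr_ge0 ?normal_peak_ge0 ?sqr_ge0 ?invr_ge0 ?ltW.
pose F (y : R) : R := - K * normal_fun 0 s y.
pose f (y : R) : R := K * (y / s ^+ 2 * normal_fun 0 s y).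
have dF (y : R) : is_derive y (1 : R) F (f y).
  have := is_derive_normal_fun y s0 => ?.
  apply: is_derive_eq.
  by rewrite /f /GRing.scale/= !mulNr mulrN opprK.
have cf : continuous f.
  move=> y; apply: cvgM; first exact: cvg_cst.
  apply: cvgM; first by apply: cvgM; [exact: cvg_id|exact: cvg_cst].
  have dN := is_derive_normal_fun y s0.
  by apply: differentiable_continuous; apply/derivable1_diffP; exact: ex_derive.
have -> : s / (x * Num.sqrt (2 * pi)) * expR (- (x ^+ 2 / (2 * s ^+ 2))) = - F x.
  rewrite /F mulNr opprK /K /normal_fun subr0.
  rewrite mulNr [2 * s ^+ 2]mulr_natl; congr (_ * _).
  rewrite /normal_peak (_ : s ^+ 2 * pi *+ 2 = s ^+ 2 * (2 * pi)); last by ring.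
  rewrite [Num.sqrt (s ^+ 2 * _)]sqrtrM ?sqr_ge0// sqrtr_sqr gtr0_norm//.
  have P0 : Num.sqrt (2 * pi) != 0 :> R.
    by rewrite gt_eqF// sqrtr_gt0 mulr_gt0// pi_gt0.
  by field; rewrite xN0 P0 sN0.
rewrite EFinN -[leRHS]add0e -(@ge0_continuous_FTC2y _ f F x 0)//.
- apply: ge0_le_integral => //=.
  + by move=> y _; rewrite lee_fin normal_pdf_ge0.
  + by apply/measurable_EFinP/measurable_funTS; exact: measurable_normal_pdf.
  + by apply/measurable_EFinP/measurable_funTS; exact: continuous_measurable_fun.
  + move=> y; rewrite in_itv/= andbT => xy; rewrite lee_fin normal_pdfE//.
    rewrite /f /K mulrA ler_wpM2r ?normal_fun_ge0//.
    have -> : normal_peak s * s ^+ 2 / x * (y / s ^+ 2) = normal_peak s * (y / x).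
      by field; rewrite xN0 sN0.
    by rewrite ler_peMr ?normal_peak_ge0// ler_pdivlMr ?mul1r.
- move=> y xy; rewrite /f mulr_ge0// mulr_ge0 ?normal_fun_ge0//.
  by rewrite divr_ge0 ?sqr_ge0// (le_trans (ltW x0)).
- exact: continuous_subspaceT.
- rewrite -(mulr0 (- K)); apply: cvgM; first exact: cvg_cst.
  rewrite (_ : normal_fun 0 s = gauss_fun (R := R) \o *%R (s * Num.sqrt 2)^-1); last first.
    by apply/funext => y; rewrite /= normal_fun_gauss.
  apply: (@cvg_comp _ _ _ _ _ _ (pinfty_nbhs R)); last exact: cvg_gauss_fun.
  apply: gt0_cvgMry; last exact: cvg_id.
  by rewrite invr_gt0 mulr_gt0// sqrtr_gt0.
- have dFx := dF x; apply: cvg_at_right_filter.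
  by apply: differentiable_continuous; apply/derivable1_diffP; exact: ex_derive.
- by move=> y _; have dFy := dF y; rewrite derive1E derive_val.
Qed.

(** * Linear combinations of independent Gaussian variables *)

(** The weight [r] is meant for the probability of a side event to which a joint law is
    restricted. *)
Lemma normal_prob_conv_scaled (R : realType) (r : {nonneg R}) (s t c : R)
    (V : set R) :
  0 < s -> 0 < t -> measurable V ->
  (mscale r (normal_prob 0 t) \x normal_prob 0 s)%E [set z | V (c * z.1 + z.2)] =
  (r%:num%:E * normal_prob 0 (Num.sqrt ((c * t) ^+ 2 + s ^+ 2)) V)%E.
Proof.
move=> s0 t0 mV; rewrite -normal_prob_conv// /product_measure1/=.
rewrite ge0_integral_mscale//.
exact: measurable_fun_xsection (measurable_linear_set c mV).
Qed.

Section linear_combination.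
Context (R : realType) (d : measure_display) (Omega : measurableType d).
Variables (P : probability Omega R) (I : finType) (E : I -> {RV P >-> R}).
Variable sigma : R.
Hypothesis sigma_gt0 : 0 < sigma.
Hypothesis E_normal : forall i (V : set R), measurable V ->
  distribution P (E i) V = normal_prob 0 sigma V.
Hypothesis E_indep : mutually_independent E.

Lemma measurable_lincomb (c : I -> R) (L : seq I) :
  measurable_fun [set: Omega] (fun w => \sum_(i <- L) c i * E i w).
Proof. by apply: measurable_sum => i; exact: measurable_funM. Qed.

Let cap_event (J : {set I}) (B : I -> set R) :=
  \bigcap_(i in [set` J]) (E i @^-1` B i).

Let measurable_cap_event (J : {set I}) (B : I -> set R) :
  (forall i, i \in J -> measurable (B i)) -> measurable (cap_event J B).
Proof.
move=> mB; apply: fin_bigcap_measurable => [|i iJ]; first exact: finite_finset.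
by apply: measurable_funPTI; exact: mB.
Qed.

(** Merges a constraint on a fresh index with the others, giving the form to which independence and
    the induction hypothesis apply. *)
Let cap_eventU1 e (J : {set I}) (B : I -> set R) (W : set R) : e \notin J ->
  cap_event (e |: J) (fun i => if i == e then W else B i) =
  E e @^-1` W `&` cap_event J B.
Proof.
move=> eJ; apply/seteqP; split => [w Bw|w [Ww Bw] i].
  split; first by have := Bw e; rewrite /= eqxx; apply; rewrite setU11.
  move=> i /= iJ; have := Bw i; rewrite /= ifF.
    by apply; rewrite in_setU1 iJ orbT.
  by apply: contraNF eJ => /eqP <-.
rewrite /= in_setU1; case: eqVneq => [->//|_ /=]; exact: Bw.
Qed.

Let prob_cap_eventU1 e (J : {set I}) (B : I -> set R) (W : set R) :
  e \notin J ->
  (\prod_(i in e |: J) P (E i @^-1` (if i == e then W else B i)) =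
   P (E e @^-1` W) * \prod_(i in J) P (E i @^-1` B i))%E.
Proof.
move=> eJ; rewrite big_setU1//= eqxx; congr (_ * _)%E.
by apply: eq_bigr => i iJ; rewrite ifF//; apply: contraNF eJ => /eqP <-.
Qed.

(* The statement is generalized over independent events outside [L] so that
   independence of the partial sums is part of the induction hypothesis. *)
Lemma normal_lincomb_joint (c : I -> R) (L : seq I) :
  L != [::] -> uniq L -> (forall i, i \in L -> c i != 0) ->
  forall (V : set R) (J : {set I}) (B : I -> set R), measurable V ->
  (forall i, i \in J -> measurable (B i)) -> (forall i, i \in L -> i \notin J) ->
  P ([set w | V (\sum_(i <- L) c i * E i w)] `&`
     \bigcap_(i in [set` J]) (E i @^-1` B i)) =
  (normal_prob 0 (sigma * Num.sqrt (\sum_(i <- L) c i ^+ 2)) V *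
   \prod_(i in J) P (E i @^-1` B i))%E.
Proof.
(* The induction starts from one term because the empty sum is constant. The constraint on that term
   joins those on [J], and independence over [e |: J] concludes. *)
elim: L => // e L; have [-> _ _ _ c0 V J B mV mB LJ|L0] := eqVneq L [::].
  have eJ : e \notin J by apply: LJ; rewrite mem_head.
  have ce0 : c e != 0 by apply: c0; rewrite mem_head.
  rewrite big_seq1 sqrtr_sqr mulrC -normal_prob_scale//; last by rewrite gt_eqF.
  under eq_set do rewrite big_seq1.
  have mW : measurable [set x | V (c e * x)].
    rewrite -[X in measurable X]setTI.
    have mc : measurable_fun [set: R] (fun x => c e * x) by exact: measurable_funM.
    exact: mc.
  rewrite -(E_normal e)// -prob_cap_eventU1// -E_indep; last first.
    by move=> i; rewrite in_setU1; case: eqVneq => //= _; exact: mB.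
  rewrite -[X in _ = P X]/(cap_event _ _) cap_eventU1//.
move=> /(_ isT) IH _ /= /andP[eL uL] c0 V J B mV mB LJ.
have eJ : e \notin J by apply: LJ; rewrite mem_head.
have cL0 i : i \in L -> c i != 0 by move=> iL; rewrite c0// in_cons iL orbT.
have {}IH := IH uL cL0.
have L'J i : i \in L -> i \notin e |: J.
  move=> iL; rewrite in_setU1 negb_or; apply/andP; split.
    by apply: contraNneq eL => <-.
  by apply: LJ; rewrite in_cons iL orbT.
pose s := sigma * Num.sqrt (\sum_(i <- L) c i ^+ 2).
have s0 : 0 < s.
  rewrite mulr_gt0// sqrtr_gt0.
  case: {IH uL s eL LJ c0 L'J} L L0 cL0 => // e' L _ cL0.
  rewrite big_cons ltr_wpDr ?sumr_ge0//; first by move=> i _; rewrite sqr_ge0.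
  by rewrite exprn_even_gt0//= cL0// mem_head.
have mG := measurable_cap_event mB.
set G := cap_event J B in mG.
have PG : P G = (\prod_(i in J) P (E i @^-1` B i))%E by exact: E_indep.
have PGE : P G = (fine (P G))%:E by rewrite fineK// fin_num_measure.
pose h w : measurableTypeR R * measurableTypeR R :=
  (E e w, \sum_(i <- L) c i * E i w).
have mh : measurable_fun setT h.
  apply: measurable_fun_pair; first exact: (measurable_funPT (E e)).
  exact: measurable_lincomb.
pose hM : {mfun _ >-> _} := HB.pack h (isMeasurableFun.Build _ _ _ _ h mh).
(* [m'] is the joint law of [E e] and the remaining sum, restricted to [G]. The induction
   hypothesis, with [e] added to [J], factors it on rectangles, so it is a product measure by
   uniqueness. *)
pose m' := image_measure (mrestr P mG) hM.
pose r := NngNum (fine_ge0 (measure_ge0 P G)).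
have m'E A C : measurable A -> measurable C ->
    m' (A `*` C) = (mscale r (normal_prob 0 sigma) A * normal_prob 0 s C)%E.
  move=> mA mC; rewrite /m' /image_measure /pushforward /mrestr.
  transitivity (P ([set w | C (\sum_(i <- L) c i * E i w)] `&`
      cap_event (e |: J) (fun i => if i == e then A else B i))).
    rewrite cap_eventU1// setIA; congr (P (_ `&` _)).
    by apply/seteqP; split => w [].
  rewrite IH//; last first.
    by move=> i; rewrite in_setU1; case: eqVneq => //= _; exact: mB.
  rewrite prob_cap_eventU1// -PG -/s /mscale/= -PGE -(E_normal e)//.
  by rewrite muleC; congr (_ * _)%E; rewrite muleC.
have := product_measure_unique m'E (measurable_linear_set (c e) mV).
rewrite normal_prob_conv_scaled// => convE.
transitivity (m' [set z | V (c e * z.1 + z.2)]).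
  rewrite /m' /image_measure /pushforward /mrestr; congr (P (_ `&` _)).
  by apply/seteqP; split => w /=; rewrite big_cons.
rewrite [LHS](esym convE) -PG [in RHS]PGE muleC; congr (normal_prob 0 _ V * _)%E.
rewrite big_cons /s !exprMn sqr_sqrtr; last first.
  by apply: sumr_ge0 => i _; rewrite sqr_ge0.
rewrite [c e ^+ 2 * _]mulrC -mulrDr sqrtrM ?sqr_ge0// sqrtr_sqr gtr0_norm//.
Qed.

(** Zero coefficients are dropped first, as their terms are not Gaussian; [0 < s] ensures that some
    term remains. The joint law is then used without side events. *)
Lemma normal_lincomb_tail (c : I -> R) (s x : R) :
  s = sigma * Num.sqrt (\sum_i c i ^+ 2) -> 0 < s -> 0 < x ->
  (P [set w | (x <= \sum_i c i * E i w)%R] <=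
   (s / (x * Num.sqrt (2 * pi)) * expR (- (x ^+ 2 / (2 * s ^+ 2))))%:E)%E.
Proof.
move=> sE s0 x0.
pose L := [seq i <- index_enum I | c i != 0].
have sumL (F : I -> R) : (forall i, c i = 0 -> F i = 0) ->
    \sum_i F i = \sum_(i <- L) F i.
  move=> F0; rewrite big_filter [LHS](bigID (fun i => c i != 0))/=.
  by rewrite [X in _ + X]big1 ?addr0// => i /negPn/eqP/F0.
have cL : \sum_i c i ^+ 2 = \sum_(i <- L) c i ^+ 2.
  by apply: sumL => i ->; rewrite expr0n.
have L0 : L != [::].
  by apply: contraTneq s0 => L0; rewrite sE cL L0 big_nil sqrtr0 mulr0 ltxx.
have uL : uniq L by rewrite filter_uniq// index_enum_uniq.
have cL0 i : i \in L -> c i != 0 by rewrite mem_filter => /andP[].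
have := @normal_lincomb_joint c L L0 uL cL0 `[x, +oo[%classic finset.set0 (fun=> setT).
rewrite big_set0 mule1 -cL -sE => tailE.
apply: le_trans (normal_prob_tail s0 x0).
rewrite -tailE//; last by move=> i; rewrite inE.
rewrite le_eqVlt; apply/orP; left; apply/eqP; congr (P _); apply/seteqP; split => w /=.
  rewrite sumL => [xw|i ->]; last by rewrite mul0r.
  by rewrite in_itv/= xw; split => // i; rewrite /= inE.
by move=> -[]; rewrite in_itv/= andbT sumL// => i ->; rewrite mul0r.
Qed.

End linear_combination.

(** * Measurability and form of the ratio estimator *)

(** Inversion is discontinuous at zero, but [x * expR (- ln (x ^+ 2))] equals [x^-1] everywhere,
    both being [0] at zero, and is built from measurable functions. *)
Lemma measurable_funV (R : realType) d (Omega : measurableType d)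
    (f : Omega -> R) :
  measurable_fun [set: Omega] f -> measurable_fun [set: Omega] (fun w => (f w)^-1).
Proof.
move=> mf; have -> : (fun w => (f w)^-1) = (fun w => f w * expR (- ln (f w ^+ 2))).
  apply/funext => w; have [->|f0] := eqVneq (f w) 0; first by rewrite invr0 mul0r.
  rewrite expRN lnK; first by field.
  by rewrite posrE exprn_even_gt0.
apply: measurable_funM => //; apply: measurableT_comp; first exact: measurable_expR.
apply: measurableT_comp; first exact: oppr_measurable.
apply: measurableT_comp; first exact: measurable_ln.
exact: measurable_funX.
Qed.

(** In the model this is [mean_entry B *: A] plus averaged noise, see [block_mean_ols]. *)
Definition block_mean (R : realType) m q n p (C : 'M[R]_(q * m, p * n)) :
    'M[R]_(n, m) :=
  \matrix_(i < n, k < m)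
    ((p%:R * q%:R)^-1 * \sum_(j < p) \sum_(l < q) block_entry C k l i j).

(** The sums in the denominator are reordered to put [(j, l)] innermost, after which the averaging
    factor cancels in the ratio. *)
Lemma A_tilde_block_mean (R : realType) m q n p (C : 'M[R]_(q * m, p * n)) i k :
  (0 < p)%N -> (0 < q)%N ->
  A_tilde C i k = block_mean C i k /
    ((n%:R - 1)^-1 * \sum_(r < n | r != i) \sum_(s < m) block_mean C r s).
Proof.
move=> p0 q0; rewrite mxE.
have pq0 : (p%:R * q%:R)^-1 != 0 :> R.
  by rewrite invr_eq0 mulf_neq0// pnatr_eq0 -lt0n.
have -> : \sum_(j < p) \sum_(l < q) B_tilde C i l j =
    (n%:R - 1)^-1 * \sum_(r < n | r != i) \sum_(s < m)
      \sum_(j < p) \sum_(l < q) block_entry C s l r j.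
  transitivity (\sum_(j < p) \sum_(l < q) (n%:R - 1)^-1 *
      \sum_(r < n | r != i) \sum_(s < m) block_entry C s l r j).
    by apply: eq_bigr => j _; apply: eq_bigr => l _; rewrite mxE.
  under eq_bigr => j _ do rewrite -mulr_sumr.
  rewrite -mulr_sumr; congr (_ * _).
  under eq_bigr => j _ do rewrite exchange_big.
  rewrite exchange_big; apply: eq_bigr => r _.
  under eq_bigr => j _ do rewrite exchange_big.
  by rewrite exchange_big.
have -> : \sum_(r < n | r != i) \sum_(s < m) block_mean C r s =
    (p%:R * q%:R)^-1 * \sum_(r < n | r != i) \sum_(s < m)
      \sum_(j < p) \sum_(l < q) block_entry C s l r j.
  rewrite mulr_sumr; apply: eq_bigr => r _; rewrite mulr_sumr.
  by apply: eq_bigr => s _; rewrite mxE.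
by rewrite mxE mulrCA -mulf_div divff// mul1r.
Qed.

(** * Inner products with the weights of numerator and denominator *)

(** The Frobenius inner product. The noise in the numerator, in the denominator and in their
    difference is each an inner product of the averaged noise with a fixed [W]. *)
Definition mxdot (R : realType) a b (V W : 'M[R]_(a, b)) : R :=
  \sum_r \sum_s V r s * W r s.

Section mxdot.
Context (R : realType) (a b : nat).
Implicit Types V W : 'M[R]_(a, b).

Lemma mxdotNl V W : mxdot (- V) W = - mxdot V W.
Proof.
rewrite /mxdot -sumrN; apply: eq_bigr => r _; rewrite -sumrN.
by apply: eq_bigr => s _; rewrite mxE mulNr.
Qed.

Lemma mxdotC V W : mxdot V W = mxdot W V.
Proof. by apply: eq_bigr => r _; apply: eq_bigr => s _; rewrite mulrC. Qed.

Lemma mxdotDl V V' W : mxdot (V + V') W = mxdot V W + mxdot V' W.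
Proof.
rewrite /mxdot -big_split; apply: eq_bigr => r _; rewrite -big_split.
by apply: eq_bigr => s _; rewrite mxE mulrDl.
Qed.

Lemma mxdot_delta i k W : mxdot (delta_mx i k) W = W i k.
Proof.
rewrite /mxdot (bigD1 i)//= (bigD1 k)//= mxE !eqxx mul1r.
rewrite [X in _ + X + _]big1 ?addr0 => [|s /negPf sk]; last first.
  by rewrite mxE sk andbF mul0r.
rewrite big1 ?addr0// => r /negPf ri.
by apply: big1 => s _; rewrite mxE ri mul0r.
Qed.

(* Averages over the rows other than [i], as in the denominator of [A_tilde]. *)
Definition others_mx (i : 'I_a) : 'M[R]_(a, b) :=
  \matrix_(r < a, s < b) ((a%:R - 1)^-1 *+ (r != i)).

Lemma mxdot_others i W :
  mxdot (others_mx i) W = (a%:R - 1)^-1 * \sum_(r < a | r != i) \sum_s W r s.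
Proof.
rewrite mulr_sumr big_mkcond; apply: eq_bigr => r _.
case: ifPn => ri; last by apply: big1 => s _; rewrite mxE (negPf ri) mulr0n mul0r.
by rewrite mulr_sumr; apply: eq_bigr => s _; rewrite mxE ri.
Qed.

(** Each of the [a - 1] other rows contributes [c], and [1 < a] makes the normalisation
    invertible. *)
Lemma mxdot_others_row_sum i W c : (1 < a)%N -> (forall r, \sum_s W r s = c) ->
  mxdot (others_mx i) W = c.
Proof.
move=> a1 Wc; rewrite mxdot_others.
under eq_bigr => r _ do rewrite Wc.
rewrite sumr_const (_ : #|_| = a.-1); last first.
  by have := cardC1 i; rewrite card_ord => <-; apply: eq_card => r; rewrite !inE.
have -> : a%:R - 1 = a.-1%:R :> R.
  by case: a a1 i W Wc => // a' _ _ _ _; rewrite -natr1 addrK.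
rewrite -[c *+ _]mulr_natl mulrA mulVf ?mul1r// pnatr_eq0.
by case: a a1 i W Wc => [|[]].
Qed.

Lemma mxdot_others_others i : (1 < a)%N ->
  mxdot (others_mx i) (others_mx i) = b%:R / (a%:R - 1).
Proof.
(* The second factor matters only on rows other than [i], where it is constant; extending the
   constant to row [i] makes all row sums equal. *)
move=> a1; transitivity (mxdot (others_mx i) (const_mx (a%:R - 1)^-1)).
  rewrite !mxdot_others; congr (_ * _); apply: eq_bigr => r ri.
  by apply: eq_bigr => s _; rewrite !mxE ri.
rewrite (@mxdot_others_row_sum _ _ (b%:R / (a%:R - 1)))// => r.
under eq_bigr => s _ do rewrite mxE.
by rewrite sumr_const card_ord mulr_natl.
Qed.

(** The two matrices have disjoint supports, so their squared norms add up. This is the source of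
    the factor in [sigmat]. *)
Lemma mxdot_delta_others i k : (1 < a)%N ->
  let W := delta_mx i k - others_mx i in
  mxdot W W = 1 + b%:R / (a%:R - 1).
Proof.
move=> a1 W; rewrite mxdotDl mxdotNl mxdot_delta mxdotC mxdotDl mxdotNl mxdot_delta.
by rewrite mxdot_others_others// !mxE !eqxx mulr0n subr0 sub0r opprK.
Qed.

End mxdot.

(** * Least squares under an orthogonal design *)

Lemma sum_triple (V : nmodType) (I J K : finType) (F : I * J * K -> V) :
  \sum_e F e = \sum_i \sum_j \sum_k F (i, j, k).
Proof. by rewrite pair_bigA pair_bigA; apply: eq_bigr => -[[]]. Qed.

Section ols_estimator.
Context (R : realType) (m p q n T : nat).
Variables (X : 'I_T -> 'M[R]_(m, q)).
Hypothesis T_gt0 : (0 < T)%N.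
Hypothesis X_orth : (vec_rows X)^T *m vec_rows X = (T%:R)%:M.

Lemma vec_rowsE a b (M : 'I_T -> 'M[R]_(a, b)) t l s :
  vec_rows M t (mxvec_index l s) = M t s l.
Proof. by rewrite mxE mxvecE mxE. Qed.

Let T_neq0 : T%:R != 0 :> R.
Proof. by rewrite pnatr_eq0 -lt0n. Qed.

Lemma design_orth s l s' l' :
  \sum_t X t s l * X t s' l' = T%:R *+ ((s == s') && (l == l')).
Proof.
have /matrixP/(_ (mxvec_index l s) (mxvec_index l' s')) := X_orth.
rewrite !mxE => sumE.
transitivity (T%:R *+ (mxvec_index l s == mxvec_index l' s') : R).
  by rewrite -sumE; apply: eq_bigr => t _; rewrite mxE !vec_rowsE.
congr (_ *+ nat_of_bool _); apply/eqP/andP => [|[/eqP-> /eqP->]//].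
by move=> /cast_ord_inj/enum_rank_inj[-> ->]; rewrite !eqxx.
Qed.

Lemma block_entry_ols (Y : 'I_T -> 'M[R]_(n, p)) s l r j :
  block_entry (ols X Y) s l r j = T%:R^-1 * \sum_t X t s l * Y t r j.
Proof.
rewrite /block_entry /ols X_orth invmx_scalar mul_scalar_mx -scalemxAl mxE.
rewrite mxE; congr (_ * _); apply: eq_bigr => t _.
by rewrite mxE !vec_rowsE.
Qed.

(** The contribution of the noise to [block_mean], with the sum over [l] moved onto the design. *)
Definition noise_mean (N : 'I_T -> 'M[R]_(n, p)) : 'M[R]_(n, m) :=
  \matrix_(r < n, s < m) ((T%:R * p%:R * q%:R)^-1 *
     \sum_t \sum_(j < p) (\sum_(l < q) X t s l) * N t r j).

(** Orthogonality keeps only the terms [l' = l] and [s' = s] of the signal, so each least squares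
    entry is [A r s * B l j] plus noise. *)
Lemma block_mean_ols (A : 'M[R]_(n, m)) (B : 'M[R]_(q, p))
    (N : 'I_T -> 'M[R]_(n, p)) :
  block_mean (ols X (fun t => A *m X t *m B + N t)) =
  mean_entry B *: A + noise_mean N.
Proof.
apply/matrixP => r s; rewrite !mxE.
have entryE l j : block_entry (ols X (fun t => A *m X t *m B + N t)) s l r j =
    A r s * B l j + T%:R^-1 * \sum_t X t s l * N t r j.
  rewrite block_entry_ols.
  under eq_bigr => t _ do rewrite mxE mulrDr.
  rewrite big_split mulrDr/=; congr (_ + _).
  transitivity (T%:R^-1 * \sum_(l' < q) \sum_(s' < m)
      A r s' * B l' j * \sum_t X t s l * X t s' l').
    congr (_ * _).
    under [RHS]eq_bigr => l' _.
      under eq_bigr => s' _ do rewrite mulr_sumr.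
      rewrite exchange_big; over.
    rewrite [RHS]exchange_big; apply: eq_bigr => t _ /=.
    rewrite mxE mulr_sumr; apply: eq_bigr => l' _.
    rewrite mxE mulr_suml mulr_sumr; apply: eq_bigr => s' _; ring.
  under eq_bigr => l' _.
    under eq_bigr => s' _ do rewrite design_orth.
    over.
  rewrite (bigD1 l)//= (bigD1 s)//= !eqxx [X in _ + X + _]big1 => [|s' s's].
    rewrite [X in _ + X]big1 => [|l' l'l]; first by rewrite !addr0 mulrC mulfK.
    by apply: big1 => s' _; rewrite [l == l']eq_sym (negPf l'l) andbF mulr0n mulr0.
  by rewrite [s == s']eq_sym (negPf s's) mulr0n mulr0.
under eq_bigr => j _ do under eq_bigr => l _ do rewrite entryE.
under eq_bigr => j _ do rewrite big_split.
rewrite big_split mulrDr; congr (_ + _).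
  rewrite /mean_entry -mulrA mulr_suml; congr (_ * _).
  apply: eq_bigr => j _; rewrite mulr_suml.
  by apply: eq_bigr => l _; rewrite mulrC.
under eq_bigr => j _ do rewrite -mulr_sumr exchange_big.
rewrite -mulr_sumr mulrA -invfM [p%:R * q%:R * _]mulrC mulrA; congr (_ * _).
rewrite exchange_big /=.
by apply: eq_bigr => t _; apply: eq_bigr => j _; rewrite mulr_suml.
Qed.

(** Since the rows of [A] sum to one, averaging over the other rows leaves exactly [mean_entry B] as
    the signal in the denominator. *)
Lemma A_tilde_ols (A : 'M[R]_(n, m)) (B : 'M[R]_(q, p))
    (N : 'I_T -> 'M[R]_(n, p)) i k :
  (1 < n)%N -> (0 < p)%N -> (0 < q)%N -> (forall r, \sum_s A r s = 1) ->
  A_tilde (ols X (fun t => A *m X t *m B + N t)) i k =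
  (mean_entry B * A i k + noise_mean N i k) /
  (mean_entry B + mxdot (others_mx R m i) (noise_mean N)).
Proof.
move=> n1 p0 q0 A1; rewrite A_tilde_block_mean// -mxdot_others block_mean_ols.
rewrite !mxE mxdotC mxdotDl mxdotC; congr (_ / (_ + _)); last exact: mxdotC.
apply: mxdot_others_row_sum => // r.
by under eq_bigr => s _ do rewrite mxE; rewrite -mulr_sumr A1 mulr1.
Qed.

Lemma design_row_sum_orth s s' :
  \sum_t (\sum_(l < q) X t s l) * (\sum_(l < q) X t s' l) =
  (T%:R * q%:R) *+ (s == s').
Proof.
under eq_bigr => t _ do rewrite big_distrlr /=.
transitivity (\sum_(l < q) T%:R *+ (s == s') : R).
  rewrite exchange_big; apply: eq_bigr => l _.
  rewrite exchange_big (bigD1 l)//= design_orth eqxx andbT.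
  rewrite [X in _ + X]big1 ?addr0// => l' l'l.
  by rewrite design_orth [l == l']eq_sym (negPf l'l) andbF mulr0n.
by rewrite sumr_const card_ord -[LHS]mulr_natr mulrnAl.
Qed.

(** The weight of the error at [(t, r, j)] in the inner product of [W] with the averaged noise; it
    does not depend on [j]. *)
Definition noise_coef (W : 'M[R]_(n, m)) (e : 'I_T * 'I_n * 'I_p) : R :=
  (T%:R * p%:R * q%:R)^-1 *
  \sum_s W e.1.2 s * (\sum_(l < q) X e.1.1 s l).

Lemma sum_noise_mean (W : 'M[R]_(n, m)) (N : 'I_T * 'I_n * 'I_p -> R) :
  mxdot W (noise_mean (fun t => \matrix_(i < n, j < p) N (t, i, j))) =
  \sum_e noise_coef W e * N e.
Proof.
rewrite /mxdot sum_triple [RHS]exchange_big /=; apply: eq_bigr => r _.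
under eq_bigr => s _.
  rewrite mxE mulrCA mulr_sumr mulr_sumr.
  under eq_bigr => t _ do rewrite mulr_sumr mulr_sumr.
  over.
rewrite exchange_big; apply: eq_bigr => t _; rewrite exchange_big /=.
apply: eq_bigr => j _; rewrite /noise_coef /= mulr_sumr mulr_suml.
by apply: eq_bigr => s _; rewrite mxE !mulrA.
Qed.

(** The sum over [j] gives a factor [p]; orthogonality of the row sums removes the cross terms in
    [s] and gives [T * q]. Together they cancel one of the two normalising factors. *)
Lemma sum_noise_coef_sqr (W : 'M[R]_(n, m)) : (0 < p)%N -> (0 < q)%N ->
  \sum_e noise_coef W e ^+ 2 =
  (T%:R * p%:R * q%:R)^-1 * mxdot W W.
Proof.
move=> p0 q0; have pq0 : p%:R != 0 :> R /\ q%:R != 0 :> R.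
  by rewrite !pnatr_eq0 -!lt0n.
rewrite sum_triple exchange_big mulr_sumr/=; apply: eq_bigr => r _.
pose x t s := \sum_(l < q) X t s l.
transitivity ((T%:R * p%:R * q%:R)^-1 ^+ 2 * p%:R *
    \sum_t (\sum_s W r s * x t s) ^+ 2).
  rewrite mulr_sumr; apply: eq_bigr => t _.
  rewrite /noise_coef /= sumr_const card_ord exprMn -[LHS]mulr_natr.
  by rewrite mulrAC.
have -> : \sum_t (\sum_s W r s * x t s) ^+ 2 = T%:R * q%:R * \sum_s W r s ^+ 2.
  under eq_bigr => t _ do rewrite expr2 big_distrlr /=.
  rewrite exchange_big mulr_sumr; apply: eq_bigr => s _.
  rewrite exchange_big (bigD1 s)//= [X in _ + X]big1 ?addr0 => [|s' s's].
    under eq_bigr => t _ do rewrite mulrACA -expr2.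
    by rewrite -mulr_sumr design_row_sum_orth eqxx mulr1n mulrC.
  under eq_bigr => t _ do rewrite mulrACA.
  by rewrite -mulr_sumr design_row_sum_orth eq_sym (negPf s's) mulr0n mulr0.
by rewrite mulrA; congr (_ * _); field; rewrite T_neq0 pq0.1 pq0.2.
Qed.

End ols_estimator.

(** * Deterministic error bounds *)

(** A norm above [c >= 0] is nonzero, hence attained at some entry. *)
Lemma lt_mx_normP (R : realType) n m (M : 'M[R]_(n, m)) (c : R) : 0 <= c ->
  c < `|M| <-> exists ik, c < `|M ik.1 ik.2|.
Proof.
move=> c0; split=> [cM|[ik cM]].
  have M0 : mx_norm M != 0 by rewrite gt_eqF// (le_lt_trans c0).
  by have [ik ME] := mx_norm_neq0 M0; exists ik; rewrite -ME.
apply: (lt_le_trans cM); rewrite /Num.norm/= mx_normrE.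
exact: (le_bigmax _ (fun ij => `|M ij.1 ij.2|)).
Qed.

(* With [y] the ratio, [y * (beta + v) = beta * a + u] gives
   [beta * (y - a) = u - y * v], where [0 < y < 1]. *)
Lemma ratio_error (R : realType) (beta a u v eps : R) :
  0 < beta -> - u < a * beta -> u - v < beta * (1 - a) ->
  `|u| <= eps -> `|v| <= eps ->
  `|Num.max 0 (Num.min ((beta * a + u) / (beta + v)) 1) - a| <= 2 * eps / beta.
Proof.
move=> beta0 ua uva ue ve; set y := _ / _.
have num0 : 0 < beta * a + u by lra.
(* The bound on [u - v] says that the denominator exceeds the numerator, which also gives
   [y < 1]. *)
have den0 : 0 < beta + v by lra.
have y0 : 0 < y by rewrite divr_gt0.
have y1 : y < 1 by rewrite ltr_pdivrMr//; lra.
rewrite (min_l (ltW y1)) (max_r (ltW y0)).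
have yE : beta * (y - a) = u - y * v.
  have : y * (beta + v) = beta * a + u by rewrite divfK// gt_eqF.
  by move=> h; rewrite mulrBr -[beta * a](addrK u) -h; ring.
rewrite ler_pdivlMr// -[X in _ * X](gtr0_norm beta0) -normrM mulrC yE.
apply: (le_trans (ler_normB _ _)); rewrite normrM (gtr0_norm y0).
have : y * `|v| <= eps by apply: le_trans ve; rewrite ler_piMl// ltW.
by move: ue; lra.
Qed.

(** * Tail probabilities of the noise *)

Section noise_tail.
Context (R : realType) (d : measure_display) (Omega : measurableType d).
Variables (P : probability Omega R) (m p q n T : nat).
Variables (X : 'I_T -> 'M[R]_(m, q)) (sigma : R).
Variable E : 'I_T * 'I_n * 'I_p -> {RV P >-> R}.
Hypotheses (T_gt0 : (0 < T)%N) (p_gt0 : (0 < p)%N) (q_gt0 : (0 < q)%N).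
Hypothesis X_orth : (vec_rows X)^T *m vec_rows X = (T%:R)%:M.
Hypothesis sigma_gt0 : 0 < sigma.
Hypothesis E_normal : forall i (V : set R), measurable V ->
  distribution P (E i) V = normal_prob 0 sigma V.
Hypothesis E_indep : mutually_independent E.

Let noise (w : Omega) : 'M[R]_(n, m) :=
  noise_mean X (fun t => \matrix_(i < n, j < p) E (t, i, j) w).

Lemma measurable_mxdot_noise W :
  measurable_fun [set: Omega] (fun w => mxdot W (noise w)).
Proof.
under eq_fun => w do rewrite (sum_noise_mean _ _ (fun e => E e w)).
exact: measurable_lincomb.
Qed.

Lemma noise_tail W z s : 0 < mxdot W W -> 0 < z ->
  s = sigma * Num.sqrt (mxdot W W / (T%:R * p%:R * q%:R)) ->
  (P [set w | (z <= mxdot W (noise w))%R] <=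
   (s / (z * Num.sqrt (2 * pi)) * expR (- (z ^+ 2 / (2 * s ^+ 2))))%:E)%E.
Proof.
move=> W0 z0 sE.
under eq_set => w do rewrite (sum_noise_mean _ _ (fun e => E e w)).
apply: (normal_lincomb_tail sigma_gt0 E_normal E_indep) => //.
  by rewrite sum_noise_coef_sqr// sE [mxdot _ _ / _]mulrC.
by rewrite sE mulr_gt0// sqrtr_gt0 divr_gt0// !mulr_gt0// ltr0n.
Qed.

(** Indexing by pairs of direction and threshold lets all kinds of tail event be treated alike. *)
Lemma noise_union_bound (L : seq ('M[R]_(n, m) * R)) (S : set Omega) :
  measurable S ->
  (forall w, S w -> exists2 Wz, Wz \in L & Wz.2 <= mxdot Wz.1 (noise w)) ->
  (P S <= \sum_(Wz <- L) P [set w | (Wz.2 <= mxdot Wz.1 (noise w))%R])%E.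
Proof.
move=> mS SL.
have mtail Wz : measurable [set w | Wz.2 <= mxdot Wz.1 (noise w)].
  rewrite -[X in measurable X]setTI.
  have -> : [set w | Wz.2 <= mxdot Wz.1 (noise w)] =
      (fun w => mxdot Wz.1 (noise w)) @^-1` `[Wz.2, +oo[.
    by apply/seteqP; split => w /=; rewrite in_itv/= andbT.
  exact: measurable_mxdot_noise.
pose F i := [set w | (nth (0, 0) L i).2 <= mxdot (nth (0, 0) L i).1 (noise w)].
rewrite (big_nth (0, 0)) big_mkord.
apply: (content_subadditive P (F := F)) => [k _|//|w /SL[Wz WzL Wzw]]; first exact: mtail.
rewrite -(bigcup_mkord _ F).
by exists (index Wz L); rewrite /F /= ?index_mem// nth_index.
Qed.

End noise_tail.

(** Separates the sample size [N] from the variance factor [v], to match the shape of the final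
    bound. *)
Lemma tail_boundE (R : realType) (sigma v N z : R) :
  0 < sigma -> 0 < v -> 0 < N -> 0 < z ->
  let s := sigma * Num.sqrt (v / N) in
  s / (z * Num.sqrt (2 * pi)) * expR (- (z ^+ 2 / (2 * s ^+ 2))) =
  sigma * Num.sqrt v / (z * Num.sqrt (2 * N * pi)) *
    expR (- (N * z ^+ 2 / (2 * (v * sigma ^+ 2)))).
Proof.
move=> sigma0 v0 N0 z0 s.
have pi0 : 0 < pi :> R by exact: pi_gt0.
congr (_ * expR (- _)); last first.
  rewrite /s exprMn sqr_sqrtr ?divr_ge0 ?ltW//.
  by field; rewrite !gt_eqF.
have -> : 2 * N * pi = N * (2 * pi) by ring.
rewrite /s [Num.sqrt (N * _)]sqrtrM ?[Num.sqrt (v / _)]sqrtrM ?sqrtrV ?ltW//.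
by field; rewrite !gt_eqF// sqrtr_gt0// mulr_gt0.
Qed.

(** * The deviation bound for [A_hat] *)

Theorem theorem3p6 (R : realType) (d : measure_display)
    (Omega : measurableType d) (P : probability Omega R)
    (n m p q T : nat) (n_ge2 : (2 <= n)%N) (m_ge1 : (1 <= m)%N)
    (p_ge1 : (1 <= p)%N) (q_ge1 : (1 <= q)%N) (T_ge1 : (1 <= T)%N)
    (sigma : R) (sigma_gt0 : 0 < sigma)
    (A : 'M[R]_(n, m)) (A_ge0 : forall i k, 0 <= A i k)
    (A_row : forall i, \sum_(k < m) `|A i k| = 1)
    (B : 'M[R]_(q, p))
    (X : 'I_T -> 'M[R]_(m, q))
    (E : 'I_T * 'I_n * 'I_p -> {RV P >-> R})
    (E_normal : forall tij (V : set R), measurable V ->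
      distribution P (E tij) V = normal_prob 0 sigma V)
    (E_indep : mutually_independent E)
    (Y : 'I_T -> Omega -> 'M[R]_(n, p))
    (Y_model : forall t w,
      Y t w = A *m X t *m B + \matrix_(i < n, j < p) E (t, i, j) w)
    (X_orth : (vec_rows X)^T *m vec_rows X = (T%:R)%:M)
    (A_lt01 : forall i k, 0 < A i k < 1) :
  let beta := mean_entry B in
  let mu := min_entry (\matrix_(i < n, k < m) (beta * (1 - A i k))) in
  let nu := min_entry (\matrix_(i < n, k < m) (A i k * beta)) in
  let sigmat := sigma * Num.sqrt (1 + m%:R / (n%:R - 1)) in
  let Tpq := T%:R * p%:R * q%:R : R in
  0 < beta ->
  forall eps : R, 0 < eps ->
  (P [set w | (2 * eps / `|beta| < `|A_hat (ols X (Y^~ w)) - A|)%R] <=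
   (n%:R * m%:R * sigma * Num.sqrt 2 / (eps * Num.sqrt (Tpq * pi)) *
      (expR (- (Tpq * eps ^+ 2 / (2 * sigma ^+ 2))) +
       Num.sqrt m%:R / Num.sqrt (n%:R - 1) *
         expR (- (Tpq * (n%:R - 1) * eps ^+ 2 / (2 * m%:R * sigma ^+ 2)))) +
    n%:R * m%:R / Num.sqrt (2 * Tpq * pi) *
      (sigmat / mu * expR (- (Tpq * mu ^+ 2 / (2 * sigmat ^+ 2))) +
       sigma / nu * expR (- (Tpq * nu ^+ 2 / (2 * sigma ^+ 2)))))%:E)%E.
Proof.
move=> beta mu nu sigmat Tpq beta_gt0 eps eps_gt0.
rewrite (gtr0_norm beta_gt0).
have n1 : 0 < n%:R - 1 :> R by rewrite subr_gt0 ltr1n.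
have n_gt0 : (0 < n)%N by exact: ltnW.
have [[i1 [k1 muE]] mu_min] :=
  min_entryP (\matrix_(i < n, k < m) (beta * (1 - A i k))) n_gt0 m_ge1.
have [[i2 [k2 nuE]] nu_min] :=
  min_entryP (\matrix_(i < n, k < m) (A i k * beta)) n_gt0 m_ge1.
rewrite -/mu in muE mu_min; rewrite -/nu in nuE nu_min.
have mu_gt0 : 0 < mu.
  by have /andP[_ A1] := A_lt01 i1 k1; rewrite muE mxE mulr_gt0// subr_gt0.
have nu_gt0 : 0 < nu.
  by have /andP[A0 _] := A_lt01 i2 k2; rewrite nuE mxE mulr_gt0.
have Tpq_gt0 : 0 < Tpq by rewrite !mulr_gt0// ltr0n.
have A1 r : \sum_s A r s = 1.
  by rewrite -(A_row r); apply: eq_bigr => s _; rewrite ger0_norm.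
pose U w := noise_mean X (fun t => \matrix_(i < n, j < p) E (t, i, j) w).
have mU W : measurable_fun setT (fun w => mxdot W (U w)).
  exact: measurable_mxdot_noise.
have YE w : Y^~ w = fun t => A *m X t *m B + \matrix_(i < n, j < p) E (t, i, j) w.
  by apply/funext => t; rewrite Y_model.
have AE w i k : A_tilde (ols X (Y^~ w)) i k =
    (beta * A i k + U w i k) / (beta + mxdot (others_mx R m i) (U w)).
  by rewrite YE A_tilde_ols.
set S := [set w | _].
have SE : S = \bigcup_(ik in [set: 'I_n * 'I_m])
    [set w | 2 * eps / beta < `|A_hat (ols X (Y^~ w)) ik.1 ik.2 - A ik.1 ik.2|].
  have c0 : 0 <= 2 * eps / beta by rewrite ltW// divr_gt0// mulr_gt0.
  apply/seteqP; split=> w.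
    by move=> /(lt_mx_normP _ c0)[ik]; rewrite mxE [X in _ + X]mxE; exists ik.
  move=> [ik _ Sw]; apply/(lt_mx_normP _ c0); exists ik.
  by rewrite mxE [X in _ + X]mxE.
(* Each entry of the error is a measurable function of two linear forms in the noise. *)
have mS : measurable S.
  rewrite SE; apply: fin_bigcup_measurable => // -[i k] _ /=.
  rewrite -[X in measurable X]setTI.
  have -> : [set w | 2 * eps / beta < `|A_hat (ols X (Y^~ w)) i k - A i k|] =
      (fun w => `|Num.max 0 (Num.min ((beta * A i k + mxdot (delta_mx i k) (U w)) /
        (beta + mxdot (others_mx R m i) (U w))) 1) - A i k|) @^-1`
        `]2 * eps / beta, +oo[.
    by apply/seteqP; split => w /=; rewrite in_itv/= andbT mxE AE mxdot_delta.
  apply: (_ : measurable_fun setT _) => //.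
  apply: measurableT_comp; first exact: normr_measurable.
  apply: measurable_funB => //; apply: measurable_maxr => //.
  apply: measurable_minr => //; apply: measurable_funM.
    exact: measurable_funD.
  by apply: measurable_funV; exact: measurable_funD.
pose D i k : 'M[R]_(n, m) := delta_mx i k.
pose V i : 'M[R]_(n, m) := others_mx R m i.
(* With [u] and [v] the inner products of the noise with [D i k] and [V i], these encode
   [|u| >= eps] and [|v| >= eps] by sign, then [u <= - nu] and [u - v >= mu]. *)
pose L (ik : 'I_n * 'I_m) := let: (i, k) := ik in
  [:: (D i k, eps); (- D i k, eps); (V i, eps); (- V i, eps);
      (- D i k, nu); (D i k - V i, mu)].
(* By contraposition: outside the six tails [ratio_error] applies, as [mu] and [nu] are lower bounds
   for the thresholds of each entry. *)
have cover w : S w -> exists2 Wz,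
    Wz \in flatten [seq L ik | ik <- index_enum _] & Wz.2 <= mxdot Wz.1 (U w).
  rewrite SE => -[[i k] _ /= Sw]; apply/hasP; apply: contraTT Sw => noL.
  have {noL} : ~~ has (fun Wz => Wz.2 <= mxdot Wz.1 (U w)) (L (i, k)).
    apply: contra noL => /hasP[Wz WzL Wzw]; apply/hasP; exists Wz => //.
    by apply/flattenP; exists (L (i, k)) => //; apply/map_f/mem_index_enum.
  rewrite /= !negb_or -!ltNge !mxdotDl !mxdotNl !mxdot_delta -/(V i).
  move=> /andP[u1 /and5P[u2 v1 v2 u3 /andP[u4 _]]].
  have nuik := nu_min i k; have muik := mu_min i k; rewrite mxE in nuik; rewrite mxE in muik.
  rewrite -leNgt mxE AE; apply: ratio_error; rewrite -/(V i) ?ler_norml//.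
  - exact: (lt_le_trans u3 nuik).
  - exact: (lt_le_trans u4 muik).
  - by rewrite lerNl !ltW.
  - by rewrite lerNl !ltW.
have := noise_union_bound (E := E) mS cover.
move=> /le_trans; apply.
pose tail (v z : R) := sigma * Num.sqrt v / (z * Num.sqrt (2 * Tpq * pi)) *
  expR (- (Tpq * z ^+ 2 / (2 * (v * sigma ^+ 2)))).
have tailP W z v : mxdot W W = v -> 0 < v -> 0 < z ->
    (P [set w | (z <= mxdot W (U w))%R] <= (tail v z)%:E)%E.
  move=> Wv v0 z0; rewrite /tail -tail_boundE//.
  by apply: (noise_tail T_ge1 p_ge1 q_ge1 X_orth sigma_gt0 E_normal E_indep); rewrite ?Wv.
have D1 i k : mxdot (D i k) (D i k) = 1 by rewrite mxdot_delta mxE !eqxx.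
have Vv i : mxdot (V i) (V i) = m%:R / (n%:R - 1) by exact: mxdot_others_others.
have DVv i k : mxdot (D i k - V i) (D i k - V i) = 1 + m%:R / (n%:R - 1).
  exact: mxdot_delta_others.
have NN (W : 'M[R]_(n, m)) : mxdot (- W) (- W) = mxdot W W.
  by rewrite mxdotNl mxdotC mxdotNl opprK.
have m_gt0 : 0 < m%:R :> R by rewrite ltr0n.
have v0 : 0 < m%:R / (n%:R - 1) :> R by rewrite divr_gt0.
pose c := tail 1 eps + (tail 1 eps + (tail (m%:R / (n%:R - 1)) eps +
  (tail (m%:R / (n%:R - 1)) eps + (tail 1 nu + tail (1 + m%:R / (n%:R - 1)) mu)))).
apply: (@le_trans _ _ (\sum_(ik : 'I_n * 'I_m) c%:E)%E).
  rewrite big_flatten big_map; apply: lee_sum => -[i k] _.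
  rewrite /= !big_cons big_nil adde0 /c !EFinD.
  by do ![apply: leeD]; apply: tailP; rewrite /= ?NN ?D1 ?Vv ?DVv ?addr_gt0.
rewrite (sumEFin _ _ (fun=> c)) lee_fin sumr_const card_prod !card_ord -[_ *+ _]mulr_natl natrM.
(* The sum of the tail bounds is equal to the stated right-hand side. *)
rewrite le_eqVlt; apply/orP; left; apply/eqP.
have pi0 : 0 < pi :> R by exact: pi_gt0.
have sigmat2 : sigmat ^+ 2 = (1 + m%:R / (n%:R - 1)) * sigma ^+ 2.
  rewrite exprMn sqr_sqrtr; first by rewrite mulrC.
  by rewrite addr_ge0// ltW.
have exp_others : Tpq * eps ^+ 2 / (2 * (m%:R / (n%:R - 1) * sigma ^+ 2)) =
    Tpq * (n%:R - 1) * eps ^+ 2 / (2 * m%:R * sigma ^+ 2).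
  by field; rewrite !gt_eqF.
have g_gt0 : 0 < Num.sqrt (2 * Tpq * pi) by rewrite sqrtr_gt0 mulr_gt0// mulr_gt0.
(* The [2] on the right counts the two signs of the tails at [eps]. *)
have gE : Num.sqrt 2 / Num.sqrt (Tpq * pi) = 2 / Num.sqrt (2 * Tpq * pi).
  rewrite -mulrA [Num.sqrt (2 * (Tpq * pi))]sqrtrM// -[X in X / (_ * _)](@sqr_sqrtr _ 2)//.
  by field; rewrite !gt_eqF ?sqrtr_gt0// mulr_gt0.
have -> : n%:R * m%:R * sigma * Num.sqrt 2 / (eps * Num.sqrt (Tpq * pi)) =
    n%:R * m%:R * sigma / eps * (2 / Num.sqrt (2 * Tpq * pi)).
  by rewrite -gE; field; rewrite !gt_eqF ?sqrtr_gt0// mulr_gt0.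
rewrite /c /tail -sigmat2 -/sigmat exp_others sqrtr1 !mul1r mulr1.
rewrite [Num.sqrt (m%:R / _)]sqrtrM ?sqrtrV ?ltW//.
clearbody mu nu Tpq sigmat.
by field; rewrite !gt_eqF// sqrtr_gt0.
Qed.
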